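(* Let $N\ge2$. For $l=0,\ldots,N$, the functions $\widetilde e_l(x):=e_l(e^{x_1},\ldots,e^{x_N})$ are eigenfunctions, for all $k\in\,]0,\infty[$, of the operator $$\widetilde L_k=\frac1k\Delta+\sum_{j=1}^N\sum_{m\ne j}\coth\Bigl(\frac{x_j-x_m}2\Bigr)\frac{\partial}{\partial x_j}$$ with eigenvalue $l\bigl(\frac1k+N-l\bigr)\ge0$, i.e. $\widetilde L_k\widetilde e_l=l(\frac1k+N-l)\,\widetilde e_l$.
   Context: $e_l$ is the $l$-th elementary symmetric polynomial in $N$ variables. The identity is understood on $C_N^A=\{x\in\mathbb R^N:x_1\ge x_2\ge\ldots\ge x_N\}$, with the singular terms evaluated at points with pairwise distinct coordinates and extended by continuity. $\widetilde L_k$ is the non-compact $W$-invariant Heckman-Opdam Laplacian of type $A_{N-1}$ divided by $k$. *)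

(* Defs.v *)
From HB Require Import structures.
From mathcomp Require Import all_boot all_order all_algebra.
From mathcomp Require Import all_classical all_reals all_analysis.
(* Not imported: its notations clash with those of MathComp-Analysis. *)
From mathcomp Require mpoly.

Set Implicit Arguments.
Unset Strict Implicit.
Unset Printing Implicit Defensive.

Import Order.TTheory GRing.Theory Num.Theory.
Import numFieldNormedType.Exports.
Local Open Scope classical_set_scope.
Local Open Scope ring_scope.

(* Takes the junk value 0 at the pole u = 0. *)
Definition coth (R : realType) (u : R) : R :=
  (expR u + expR (- u)) / (expR u - expR (- u)).

Definition stdbasis (R : realType) (N : nat) (j : 'I_N) : 'rV[R]_N :=
  delta_mx ord0 j.

Definition partial (R : realType) (N : nat) (j : 'I_N)
    (f : 'rV[R]_N -> R) (x : 'rV[R]_N) : R := 'D_(stdbasis R j) f x.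

(* 'D_v is total; this says that the derivatives entering the Laplacian and
   the first-order part are genuine derivatives. *)
Definition has_partials2 (R : realType) (N : nat) (f : 'rV[R]_N -> R) : Prop :=
  forall (j : 'I_N) (x : 'rV[R]_N),
    derivable f x (stdbasis R j) /\ derivable (partial j f) x (stdbasis R j).

Definition laplacian (R : realType) (N : nat) (f : 'rV[R]_N -> R)
    (x : 'rV[R]_N) : R :=
  \sum_(j < N) partial j (partial j f) x.

(* The closed Weyl chamber C_N^A. *)
Definition chamberA (R : realType) (N : nat) : set 'rV[R]_N :=
  [set x | forall i j : 'I_N, (i <= j)%N -> x ord0 j <= x ord0 i].

Definition regular (R : realType) (N : nat) : set 'rV[R]_N :=
  [set x | forall i j : 'I_N, i != j -> x ord0 i != x ord0 j].

Definition drift (R : realType) (N : nat) (f : 'rV[R]_N -> R)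
    (x : 'rV[R]_N) : R :=
  \sum_(j < N) \sum_(m < N | m != j)
    coth ((x ord0 j - x ord0 m) / 2) * partial j f x.

(* The operator at points with pairwise distinct coordinates. *)
Definition HOlaplacian (R : realType) (N : nat) (k : R) (f : 'rV[R]_N -> R)
    (x : 'rV[R]_N) : R :=
  k^-1 * laplacian f x + drift f x.

(* Filter of approach to x through points of the chamber with pairwise
   distinct coordinates, along which the singular terms are extended. *)
Definition regular_nbhs (R : realType) (N : nat) (x : 'rV[R]_N) :
    set_system 'rV[R]_N :=
  within (@chamberA R N `&` @regular R N) (nbhs x).

(* Only the sum of the singular terms is extended: on a wall the individual
   summands coth ((x_j - x_m) / 2) * d_j f need not converge. *)
Definition drift_ext (R : realType) (N : nat) (f : 'rV[R]_N -> R)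
    (x : 'rV[R]_N) : R :=
  lim (drift f @ regular_nbhs x).

Definition HOlaplacian_ext (R : realType) (N : nat) (k : R)
    (f : 'rV[R]_N -> R) (x : 'rV[R]_N) : R :=
  k^-1 * laplacian f x + drift_ext f x.

Definition etilde (R : realType) (N l : nat) (x : 'rV[R]_N) : R :=
  mpoly.meval (fun i : 'I_N => expR (x ord0 i)) (mpoly.mesym N R l).

(* Main.v *)
(** Each monomial [y_A], the product of [e^(x_i)] over [i] in [A], satisfies
    [d_j y_A = [j in A] y_A], so [Delta e_l = l e_l].  Since [coth] is odd, twice
    the drift is the sum over all pairs [(j, m)] of
    [coth ((x_j - x_m) / 2) (d_j e_l - d_m e_l)].  Exchanging [j] and [m] in the
    index sets shows that this summand equals the sum of the [y_A] for which [A]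
    separates [j] from [m], without singularity; each [A] of cardinality [l]
    separates [2 l (N - l)] ordered pairs. *)
Require Import Defs.
From HB Require Import structures.
From mathcomp Require Import all_boot all_order all_algebra.
From mathcomp Require Import perm ring.
From mathcomp Require Import all_classical all_reals all_analysis.
From mathcomp Require mpoly.
Import Order.TTheory GRing.Theory Num.Theory.
Import numFieldNormedType.Exports.
Local Open Scope classical_set_scope.
Local Open Scope ring_scope.

(** The difference quotient of [f] at [a] along [v] is that of [h |-> f (h *: v + a)] at 0, so
    partial derivatives reduce to one-variable calculus. *)
Lemma is_derive_line {R : realType} (V W : normedModType R) (f : V -> W)
    (a v : V) (df : W) :
  is_derive (0 : R) 1 (fun h : R => f (h *: v + a)) df -> is_derive a v f df.
Proof.
move=> [dfl dfE].
have quotE : (fun h : R => h^-1 *: ((f \o shift a) (h *: v) - f a))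
    = (fun h : R => h^-1 *:
       (((fun h => f (h *: v + a)) \o shift 0) (h *: (1 : R)) - f (0 *: v + a))).
  by apply/funext => h /=; rewrite addr0 scale0r add0r [h *: 1]mulr1.
by split; [rewrite /derivable quotE | rewrite /derive quotE].
Qed.

Lemma is_derive_bigsum {R : realType} (V W : normedModType R) (I : Type)
    (r : seq I) (P : pred I) (f : I -> V -> W) (df : I -> W) (a v : V) :
  (forall i, P i -> is_derive a v (f i) (df i)) ->
  is_derive a v (fun x => \sum_(i <- r | P i) f i x) (\sum_(i <- r | P i) df i).
Proof.
move=> dP; rewrite -fct_sumE.
elim/big_ind2 : _ => // [|? ? ? ? ? ?]; first exact: is_derive_cst.
exact: is_deriveD.
Qed.

(** * Weighted sums of exponential monomials and their derivatives *)

Section ExponentialMonomials.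
Context {R : realType} {N : nat}.
Implicit Types (A : {set 'I_N}) (i j m : 'I_N) (x : 'rV[R]_N) (l : nat).

Definition exp_monomial A x : R := \prod_(i in A) expR (x ord0 i).

(** The weights [w] make this class stable under every partial derivative; indicator weights select
    the sets [A] that contain or separate given indices. *)
Definition exp_poly (l : nat) (w : {set 'I_N} -> R) x : R :=
  \sum_(A : {set 'I_N} | #|A| == l) w A * exp_monomial A x.

Lemma etildeE l : @etilde R N l = exp_poly l (fun=> 1).
Proof.
apply/funext => x; rewrite /etilde /mpoly.mesym /exp_poly.
rewrite (big_morph _ (mpoly.mevalD _) (mpoly.meval0 _)).
apply: eq_bigr => A _.
rewrite mul1r (big_morph _ (mpoly.mevalM _) (mpoly.meval1 _)).
by apply: eq_bigr => i _; rewrite mpoly.mevalXU.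
Qed.

Lemma exp_monomial_shift A j x (h : R) :
  exp_monomial A (h *: stdbasis R j + x)
  = expR (h * (j \in A)%:R) * exp_monomial A x.
Proof.
rewrite /exp_monomial; have [jA|jA] := boolP (j \in A).
  rewrite (bigD1 j jA) [in RHS](bigD1 j jA) /= !mxE !eqxx /= expRD mulrA.
  congr (_ * _); apply: eq_bigr => i /andP[_ /negPf ij].
  by rewrite !mxE eqxx ij mulr0 add0r.
rewrite mulr0 expR0 mul1r; apply: eq_bigr => i iA.
rewrite !mxE eqxx (_ : (i == j) = false) ?mulr0 ?add0r //.
by apply/negbTE/(contraNneq _ jA) => <-.
Qed.

Lemma is_derive_exp_monomial A j x :
  is_derive x (stdbasis R j) (exp_monomial A)
    ((j \in A)%:R * exp_monomial A x).
Proof.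
apply: is_derive_line.
have -> : (fun h : R => exp_monomial A (h *: stdbasis R j + x))
    = (fun h : R => exp_monomial A x *: expR (h * (j \in A)%:R)).
  by apply/funext => h; rewrite exp_monomial_shift [RHS]mulrC.
case: (j \in A); last first.
  under eq_fun do rewrite mulr0.
  by rewrite mul0r; exact: is_derive_cst.
under eq_fun do rewrite mulr1.
apply: is_derive_eq.
by rewrite expR0 mul1r [LHS]mulr1.
Qed.

Lemma is_derive_exp_poly l w j x :
  is_derive x (stdbasis R j) (exp_poly l w)
    (exp_poly l (fun A => w A * (j \in A)%:R) x).
Proof.
apply: is_derive_bigsum => A _; rewrite -mulrA.
exact: (is_deriveZ _ (is_derive_exp_monomial A j x)).
Qed.

Lemma partial_exp_poly l w j :
  partial j (exp_poly l w) = exp_poly l (fun A => w A * (j \in A)%:R).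
Proof.
by apply/funext => x; have /@derive_val := is_derive_exp_poly l w j x.
Qed.

Lemma has_partials2_exp_poly l w : has_partials2 (exp_poly l w).
Proof.
move=> j x; rewrite partial_exp_poly.
by split; apply: ex_derive; exact: is_derive_exp_poly.
Qed.

Lemma continuous_exp_poly l w : continuous (exp_poly l w).
Proof.
apply: continuous_big => [|A _ x]; first exact: add_continuous.
suff cA : exp_monomial A y @[y --> x] --> exp_monomial A x.
  exact: (cvgM (cvg_cst (w A)) cA).
have prodE : exp_monomial A = (fun y => \prod_(i in A) expR (y ord0 i)) by [].
rewrite prodE; move: x; apply: continuous_big => [|i _ x].
  exact: mul_continuous.
apply: continuous_comp; first exact: coord_continuous.
exact: continuous_expR.
Qed.

Lemma sum_indicator A : \sum_(j < N) ((j \in A)%:R : R) = #|A|%:R.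
Proof. by rewrite -natr_sum -big_mkcond /= sum1_card. Qed.

Lemma laplacian_exp_poly l x :
  laplacian (exp_poly l (fun=> 1)) x = l%:R * exp_poly l (fun=> 1) x.
Proof.
rewrite /laplacian; under eq_bigr do rewrite !partial_exp_poly.
rewrite exchange_big mulr_sumr /=; apply: eq_bigr => A /eqP Al.
rewrite -mulr_suml mul1r -Al -sum_indicator; congr (_ * _).
(* The indicator of [j \in A] is idempotent, so the second derivative counts each [j] in [A]
   once. *)
by apply: eq_bigr => j _; case: (j \in A); rewrite !(mulr1, mulr0).
Qed.

End ExponentialMonomials.

(** * The drift term at points with distinct coordinates *)

Section Drift.
Context {R : realType} {N : nat}.

Lemma coth0 : coth (0 : R) = 0.
Proof. by rewrite /coth oppr0 subrr invr0 mulr0. Qed.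

Lemma cothN (u : R) : coth (- u) = - coth u.
Proof. by rewrite /coth opprK -(opprB (expR u)) invrN mulrN addrC. Qed.

(** With [p = expR (a / 2)] and [q = expR (b / 2)], multiply numerator and denominator of [coth] by
    [p * q]. *)
Lemma coth_half (a b : R) : a != b ->
  coth ((a - b) / 2) = (expR a + expR b) / (expR a - expR b).
Proof.
move=> ab.
have := expR_gt0 (a / 2); have := expR_gt0 (b / 2).
have : expR (a / 2) != expR (b / 2).
  by apply: contra_neq ab => /expR_inj; apply: divIf; rewrite pnatr_eq0.
rewrite /coth (_ : expR a = expR (a / 2) ^+ 2); last first.
  by rewrite -expRM_natl; congr expR; field.
rewrite (_ : expR b = expR (b / 2) ^+ 2); last first.
  by rewrite -expRM_natl; congr expR; field.
rewrite (_ : (a - b) / 2 = a / 2 - b / 2) 1?mulrBl // opprB !expRD !expRN.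
move: (expR (b / 2)) (expR (a / 2)) => q p pq q0 p0.
have pq2 : p ^+ 2 - q ^+ 2 != 0.
  by rewrite subr_sqr mulf_neq0 ?subr_eq0 // lt0r_neq0 // addr_gt0.
field.
by rewrite pq2 !lt0r_neq0.
Qed.

Lemma driftMn2 (f : 'rV[R]_N -> R) (x : 'rV[R]_N) :
  drift f x *+ 2 = \sum_(j < N) \sum_(m < N)
    coth ((x ord0 j - x ord0 m) / 2) * (partial j f x - partial m f x).
Proof.
(* The diagonal terms may be added because of the junk value [coth 0 = 0]. *)
have -> : drift f x = \sum_(j < N) \sum_(m < N)
    coth ((x ord0 j - x ord0 m) / 2) * partial j f x.
  apply: eq_bigr => j _; rewrite big_mkcond /=; apply: eq_bigr => m _.
  by case: eqVneq => // ->; rewrite subrr mul0r coth0 mul0r.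
rewrite mulr2n [X in _ + X]exchange_big -big_split /=.
apply: eq_bigr => j _; rewrite -big_split /=; apply: eq_bigr => m _.
by rewrite mulrBr -(opprB (x ord0 j)) mulNr cothN mulNr.
Qed.

(** The preimage is [A] with [j] replaced by [m]; both sides are the product of [expR (x ord0 i)]
    over [A] together with [m]. *)
Lemma exp_monomial_tperm (A : {set 'I_N}) (j m : 'I_N) (x : 'rV[R]_N) :
  j \in A -> m \notin A ->
  expR (x ord0 j) * exp_monomial (tperm j m @^-1: A) x
  = expR (x ord0 m) * exp_monomial A x.
Proof.
move=> jA mA; rewrite /exp_monomial (reindex_inj (@perm_inj _ (tperm j m))) /=.
rewrite (eq_bigl (mem A)); last by move=> i; rewrite inE tpermK.
rewrite (bigD1 j jA) [in RHS](bigD1 j jA) /= tpermL mulrCA; congr (_ * (_ * _)).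
apply: eq_bigr => i /andP[iA ij]; rewrite tpermD // 1?eq_sym //.
by apply: contraNneq mA => <-.
Qed.

(* The transposition of [j] and [m] turns a monomial containing [e^(x_j)] but
   not [e^(x_m)] into one of the converse kind. *)
Lemma exp_poly_swap l (j m : 'I_N) (x : 'rV[R]_N) :
  expR (x ord0 j) * exp_poly l (fun A => ((m \in A) && (j \notin A))%:R) x
  = expR (x ord0 m) * exp_poly l (fun A => ((j \in A) && (m \notin A))%:R) x.
Proof.
have tpermKpre : involutive (fun A : {set 'I_N} => tperm j m @^-1: A).
  by move=> A; apply/setP => i; rewrite !inE tpermK.
rewrite /exp_poly (reindex_inj (inv_inj tpermKpre)) /= !mulr_sumr.
apply: eq_big => [A|A _]; first by rewrite card_preimset //; exact: perm_inj.
rewrite !inE tpermL tpermR.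
have [jA|jA] := boolP (j \in A); last by rewrite !(mul0r, mulr0).
have [mA|mA] := boolP (m \in A); first by rewrite !(mul0r, mulr0).
by rewrite !mul1r exp_monomial_tperm.
Qed.

(** The hypothesis is an implication so that the diagonal [j = m], where both sides vanish, is
    included. Off the diagonal, sets containing both indices cancel in the difference, which leaves
    [U - V]. *)
Lemma coth_exp_poly l (j m : 'I_N) (x : 'rV[R]_N) :
  (j != m -> x ord0 j != x ord0 m) ->
  coth ((x ord0 j - x ord0 m) / 2)
    * (exp_poly l (fun A => (j \in A)%:R) x
       - exp_poly l (fun A => (m \in A)%:R) x)
  = exp_poly l (fun A => ((j \in A) (+) (m \in A))%:R) x.
Proof.
move=> jm; case: (eqVneq j m) jm => [->|_ /(_ isT) xjm].
  rewrite !subrr mulr0 /exp_poly big1 // => A _.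
  by rewrite addbb mul0r.
pose U := exp_poly l (fun A => ((j \in A) && (m \notin A))%:R) x.
pose V := exp_poly l (fun A => ((m \in A) && (j \notin A))%:R) x.
have -> : exp_poly l (fun A => (j \in A)%:R) x
    - exp_poly l (fun A => (m \in A)%:R) x = U - V.
  rewrite /U /V /exp_poly -!sumrB; apply: eq_bigr => A _.
  by case: (j \in A); case: (m \in A) => /=; ring.
have -> : exp_poly l (fun A => ((j \in A) (+) (m \in A))%:R) x = U + V.
  rewrite /U /V /exp_poly -big_split; apply: eq_bigr => A _ /=.
  by case: (j \in A); case: (m \in A) => /=; ring.
have swap : expR (x ord0 j) * V = expR (x ord0 m) * U by exact: exp_poly_swap.
have ne0 : expR (x ord0 j) - expR (x ord0 m) != 0.
  by rewrite subr_eq0; apply: contra_neq xjm; exact: expR_inj.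
(* With [p = expR (x ord0 j)] and [q = expR (x ord0 m)], [(p + q) * (U - V)] and [(p - q) * (U + V)]
   differ by [2 * (q * U - p * V)], which is zero by [swap]. *)
rewrite coth_half // mulrAC; apply: (canLR (mulfK ne0)); ring: swap.
Qed.

Lemma sum_addb (A : {set 'I_N}) :
  \sum_(j < N) \sum_(m < N) (((j \in A) (+) (m \in A))%:R : R)
  = (#|A|%:R * (N%:R - #|A|%:R)) *+ 2.
Proof.
(* The count is [N - #|A|] for [j] in [A] and [#|A|] otherwise, written as an affine function of the
   indicator. *)
have inner (j : 'I_N) : \sum_(m < N) (((j \in A) (+) (m \in A))%:R : R)
    = (j \in A)%:R * (N%:R - #|A|%:R *+ 2) + #|A|%:R.
  have -> : N%:R = \sum_(m < N) (1 : R) by rewrite sumr_const card_ord.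
  rewrite -sum_indicator -sumrMnl -sumrB mulr_sumr -big_split /=.
  by apply: eq_bigr => m _; case: (j \in A); case: (m \in A) => /=; ring.
under eq_bigr do rewrite inner.
rewrite big_split /= -mulr_suml sum_indicator sumr_const card_ord -mulr_natr.
ring.
Qed.

Lemma drift_exp_poly l (x : 'rV[R]_N) : regular x ->
  drift (exp_poly l (fun=> 1)) x
  = l%:R * (N%:R - l%:R) * exp_poly l (fun=> 1) x.
Proof.
move=> xreg.
suff : drift (exp_poly l (fun=> 1)) x *+ 2
    = (l%:R * (N%:R - l%:R) * exp_poly l (fun=> 1) x) *+ 2.
  by move/eqP; rewrite eqrMn2r => /eqP.
have partialE (j : 'I_N) : partial j (exp_poly l (fun=> 1)) x
    = exp_poly l (fun A => (j \in A)%:R) x.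
  by rewrite partial_exp_poly; congr exp_poly; apply/funext => A; rewrite mul1r.
rewrite driftMn2.
have -> : \sum_(j < N) \sum_(m < N) coth ((x ord0 j - x ord0 m) / 2)
      * (partial j (exp_poly l (fun=> 1)) x
         - partial m (exp_poly l (fun=> 1)) x)
    = \sum_(j < N) \sum_(m < N)
      exp_poly l (fun A => ((j \in A) (+) (m \in A))%:R) x.
  apply: eq_bigr => j _; apply: eq_bigr => m _.
  by rewrite !partialE coth_exp_poly //; exact: xreg.
(* Two exchanges bring the sum over [A] outside, so that separated pairs are counted for each
   [A]. *)
under eq_bigr do rewrite exchange_big.
rewrite exchange_big /= mulr_sumr -sumrMnl; apply: eq_bigr => A /eqP Al.
under eq_bigr do rewrite -mulr_suml.
by rewrite -mulr_suml sum_addb Al; ring.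
Qed.

End Drift.

(** * Approaching the walls of the chamber *)

Section WeylChamber.
Context {R : realType} {N : nat}.

(** Regular points of the chamber accumulate at each of its points, walls included; properness makes
    the limit defining [drift_ext] unique. *)
Lemma regular_nbhs_proper (x : 'rV[R]_N) :
  chamberA x -> ProperFilter (regular_nbhs x).
Proof.
move=> xC; apply: Build_ProperFilter_ex => P xP.
(* Subtracting a small positive multiple of the strictly increasing vector [(0, 1, ..., N - 1)]
   makes the coordinates strictly decreasing. *)
pose d : 'rV[R]_N := \row_i i%:R.
have xd : x - t *: d @[t --> 0^'+] --> x.
  rewrite -[X in _ --> X]subr0 -(scale0r d); apply: cvgB; first exact: cvg_cst.
  by apply: cvgZr_tmp; exact: cvg_at_right_filter.
have [t [/= + t0]] :=
  filter_ex (filterI (xd _ xP : nbhs 0^'+ _) (nbhs_right_gt 0)).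
have lt_xd (i j : 'I_N) :
    (i < j)%N -> (x - t *: d) ord0 j < (x - t *: d) ord0 i.
  by move=> ij; rewrite !mxE ler_ltB ?xC 1?ltnW // ltr_pM2l // ltr_nat.
move=> xdP; exists (x - t *: d); apply: xdP; split => i j.
  by rewrite leq_eqVlt => /predU1P[/val_inj->//|/lt_xd/ltW].
by rewrite neq_ltn => /orP[] /lt_xd; [move/gt_eqF->|move/lt_eqF->].
Qed.

End WeylChamber.

Theorem mainTheorem9 (R : realType) (N : nat) (hN : (2 <= N)%N)
    (l : nat) (hl : (l <= N)%N) (k : R) (hk : 0 < k) :
  let e : 'rV[R]_N -> R := @etilde R N l in
  let lambda : R := l%:R * (k^-1 + N%:R - l%:R) in
  [/\ has_partials2 e,
      exists2 x : 'rV[R]_N, chamberA x & e x != 0,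
      0 <= lambda,
      forall x : 'rV[R]_N, chamberA x -> regular x ->
        HOlaplacian k e x = lambda * e x
    & forall x : 'rV[R]_N, chamberA x ->
        cvg (drift e @ regular_nbhs x) /\
        HOlaplacian_ext k e x = lambda * e x].
Proof.
move=> e lambda; rewrite /e etildeE; split.
- exact: has_partials2_exp_poly.
(* At the origin every monomial is 1, so the value is the number of [l]-subsets, nonzero since
   [l <= N]. *)
- exists 0; first by move=> i j _; rewrite !mxE.
  rewrite (_ : exp_poly l _ 0 = 'C(N, l)%:R) ?pnatr_eq0 -?lt0n ?bin_gt0 //.
  rewrite -[in RHS](card_ord N) -card_draws -sum1_card natr_sum /exp_poly.
  apply: eq_big => [A|A _]; first by rewrite inE.
  by rewrite mul1r /exp_monomial big1 // => i _; rewrite mxE expR0.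
- by rewrite mulr_ge0 // -addrA addr_ge0 ?subr_ge0 ?ler_nat // invr_ge0 ltW.
- move=> x _ xreg; rewrite /HOlaplacian laplacian_exp_poly drift_exp_poly //.
  by rewrite /lambda; ring.
move=> x xC; have proper_x := regular_nbhs_proper _ xC.
(* On regular points the drift equals a multiple of [exp_poly l (fun=> 1)], which is continuous
   everywhere; its value at [x] is therefore the limit. *)
have drift_cvg : drift (exp_poly l (fun=> 1)) @ regular_nbhs x
    --> l%:R * (N%:R - l%:R) * exp_poly l (fun=> 1) x.
  have e_cvg : exp_poly l (fun=> 1) @ regular_nbhs x
      --> exp_poly l (fun=> 1) x.
    by apply: cvg_within_filter; exact: continuous_exp_poly.
  have := cvgM (cvg_cst (l%:R * (N%:R - l%:R) : R)) e_cvg.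
  move=> /(_ _ _); apply: cvg_trans.
  apply: near_eq_cvg; rewrite near_withinE.
  by near=> y => -[_ /drift_exp_poly].
split; first exact: cvgP drift_cvg.
rewrite /HOlaplacian_ext /drift_ext (cvg_lim _ drift_cvg) //.
by rewrite laplacian_exp_poly /lambda; ring.
Unshelve. all: by end_near.
Qed.
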